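(* Let $q\ge2$ and let $F$ be the free group on $x_0,\dots,x_{q-1}$. For all $w\in F$ we have $$\phi(\theta(w))=\langle\langle w,\gamma(w),\dots,\gamma^{q-1}(w)\rangle\rangle,$$ (with trivial permutation), where $\gamma\colon F\to F$ is the automorphism permuting cyclically the generators, $x_i\mapsto x_{i+1\bmod q}$.
   Context: Let $A=\mathbb Z/q$. The permutational wreath product $F\wr_A\mathrm{Sym}(A)$ is the semidirect product $F^A\rtimes\mathrm{Sym}(A)$; its element with decorations $(g_0,\dots,g_{q-1})\in F^A$ and permutation $\pi$ is written $\langle\langle g_0,\dots,g_{q-1}\rangle\rangle\pi$. Convention: permutations compose as functions (right to left), $\mathrm{Sym}(A)$ acts on $F^A$ by $(\pi\cdot g)_j=g_{\pi^{-1}(j)}$, and $\langle\langle g\rangle\rangle\pi$ is the product in the semidirect product, so that $(\langle\langle g\rangle\rangle\pi)(\langle\langle h\rangle\rangle\rho)=\langle\langle g\cdot(\pi\cdot h)\rangle\rangle\pi\rho$. The group homomorphism $\phi\colon F\to F\wr_A\mathrm{Sym}(A)$ is defined by $\phi(x_0)=\langle\langle x_0,\dots,x_{q-1}\rangle\rangle(j\mapsto j+1)$ and $\phi(x_i)=\langle\langle 1,\dots,1\rangle\rangle(j\mapsto j+1)$ for $1\le i\le q-1$. The Thue-Morse endomorphism $\theta\colon F\to F$ is the group endomorphism with $\theta(x_i)=x_ix_{i+1}\cdots x_{q-1}x_0\cdots x_{i-1}$ for all $i$. *)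

(* Defs.v *)
From HB Require Import structures.
From mathcomp Require Import all_boot all_fingroup all_algebra.

Set Implicit Arguments.
Unset Strict Implicit.
Unset Printing Implicit Defensive.

Import GRing.Theory.
Local Open Scope group_scope.

(* The free group on T is realised on reduced words. The letter (x, false)
   stands for the generator x and (x, true) for its inverse. *)
Section ReducedWords.
Variable T : choiceType.
Implicit Types (a b : T * bool) (s u v w : seq (T * bool)).

Definition inv_letter a : T * bool := (a.1, ~~ a.2).

Definition reduced s := sorted (fun a b => b != inv_letter a) s.

Definition push a s :=
  if s is b :: s' then if b == inv_letter a then s' else a :: s else [:: a].

Definition word_mul u v := foldr push v u.

Definition word_inv u := rev (map inv_letter u).

Lemma inv_letterK : involutive inv_letter.
Proof. by case=> x e; rewrite /inv_letter /= negbK. Qed.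

Lemma reduced_tail a s : reduced (a :: s) -> reduced s.
Proof. exact: path_sorted. Qed.

Lemma push_reduced a s : reduced s -> reduced (push a s).
Proof.
case: s => [|b s] //= red_s; case: ifPn => [_|ne_ba].
  exact: path_sorted red_s.
by rewrite /reduced /= ne_ba.
Qed.

Lemma push_cons a s : reduced (a :: s) -> push a s = a :: s.
Proof. by case: s => [|b s] //= /andP[/negPf->]. Qed.

Lemma pushK a s : reduced s -> push (inv_letter a) (push a s) = s.
Proof.
case: s => [|b s] /= red_s; first by rewrite inv_letterK eqxx.
case: eqP => [eq_b | ne_ba]; last by rewrite /= inv_letterK eqxx.
by rewrite eq_b in red_s *; rewrite push_cons.
Qed.

Lemma pushVK a s : reduced s -> push a (push (inv_letter a) s) = s.
Proof. by move=> /(pushK (inv_letter a)); rewrite inv_letterK. Qed.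

Lemma word_mul_reduced u v : reduced v -> reduced (word_mul u v).
Proof. by move=> red_v; elim: u => //= a u; apply: push_reduced. Qed.

Lemma word_inv_reduced u : reduced u -> reduced (word_inv u).
Proof.
rewrite /reduced /word_inv rev_sorted sorted_map; apply: sub_sorted => a b /=.
by apply: contraNneq => ->; rewrite !inv_letterK.
Qed.

Lemma word_mul_push a u v :
  reduced v -> word_mul (push a u) v = push a (word_mul u v).
Proof.
move=> red_v; case: u => [|b u] //=; case: eqP => [->|_] //.
by rewrite pushVK // word_mul_reduced.
Qed.

Lemma word_mulA u v w :
  reduced w -> word_mul u (word_mul v w) = word_mul (word_mul u v) w.
Proof. by move=> red_w; elim: u => //= a u ->; rewrite word_mul_push. Qed.

Lemma word_mulw1 u : reduced u -> word_mul u [::] = u.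
Proof.
elim: u => //= a u IHu red_u.
by rewrite IHu ?push_cons //; apply: path_sorted red_u.
Qed.

Lemma word_mulVw u : reduced u -> word_mul (word_inv u) u = [::].
Proof.
elim: u => //= a u IHu red_u; have red_u' := reduced_tail red_u.
rewrite /word_mul /word_inv map_cons rev_cons foldr_rcons /= inv_letterK eqxx.
exact: IHu.
Qed.

Lemma word_invK : involutive word_inv.
Proof.
move=> u; rewrite /word_inv -map_rev revK -map_comp -[RHS]map_id.
by apply: eq_map => a; apply: inv_letterK.
Qed.

Record free_group := FreeGroup { word :> seq (T * bool); _ : reduced word }.

HB.instance Definition _ := [isSub for word].
HB.instance Definition _ := [Choice of free_group by <:].

Implicit Types x y z : free_group.

Lemma word_reduced x : reduced x. Proof. exact: valP. Qed.

Definition fg_one : free_group := @FreeGroup [::] isT.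
Definition fg_mul x y := FreeGroup (word_mul_reduced x (word_reduced y)).
Definition fg_inv x := FreeGroup (word_inv_reduced (word_reduced x)).

Lemma fg_mulA : associative fg_mul.
Proof. by move=> x y z; apply/val_inj/word_mulA/word_reduced. Qed.

Lemma fg_mul1g : left_id fg_one fg_mul.
Proof. by move=> x; apply/val_inj. Qed.

Lemma fg_mulg1 : right_id fg_one fg_mul.
Proof. by move=> x; apply/val_inj/word_mulw1/word_reduced. Qed.

Lemma fg_mulVg : left_inverse fg_one fg_inv fg_mul.
Proof. by move=> x; apply/val_inj/word_mulVw/word_reduced. Qed.

Lemma fg_mulgV : right_inverse fg_one fg_inv fg_mul.
Proof.
move=> x; rewrite -[x in fg_mul x](_ : fg_inv (fg_inv x) = x) ?fg_mulVg //.
exact/val_inj/word_invK.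
Qed.

HB.instance Definition _ :=
  isGroup.Build free_group fg_mulA fg_mul1g fg_mulg1 fg_mulVg fg_mulgV.

Definition gen (t : T) : free_group := @FreeGroup [:: (t, false)] isT.

End ReducedWords.

(* fg_lift f is the homomorphism extending f : T -> G: see fg_lift_gen,
   fg_lift_morph and fg_lift_uniq. *)
Section UniversalProperty.
Variables (T : choiceType) (G : groupType).
Implicit Types (f : T -> G) (x y : free_group T).

Definition letter_val f (a : T * bool) : G :=
  if a.2 then (f a.1)^-1 else f a.1.

Definition fg_lift f x : G := \prod_(a <- word x) letter_val f a.

Lemma letter_valV f a : letter_val f (inv_letter a) = (letter_val f a)^-1.
Proof. by case: a => t [] //=; rewrite /letter_val /= invgK. Qed.

Lemma prod_push f a s :
  \prod_(b <- push a s) letter_val f b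
  = letter_val f a * \prod_(b <- s) letter_val f b.
Proof.
case: s => [|b s] /=; first by rewrite big_seq1 big_nil mulg1.
case: eqP => [->|_]; last by rewrite big_cons.
by rewrite big_cons letter_valV mulgA mulgV mul1g.
Qed.

Lemma fg_lift_morph f : monoid.monoid_morphism (fg_lift f).
Proof.
split=> [|x y]; rewrite /fg_lift /=; first by rewrite big_nil.
rewrite /word_mul; elim: (word x) => [|a s IHs] /=.
  by rewrite big_nil mul1g.
by rewrite prod_push IHs big_cons mulgA.
Qed.

HB.instance Definition _ f :=
  isUMagmaMorphism.Build (free_group T) G (fg_lift f) (fg_lift_morph f).

Lemma fg_lift_gen f t : fg_lift f (gen t) = f t.
Proof. by rewrite /fg_lift big_seq1. Qed.

End UniversalProperty.

Lemma fg_prod_letters (T : choiceType) (x : free_group T) :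
  x = fg_lift (@gen T) x.
Proof.
apply: val_inj; case: x => s /=; rewrite /fg_lift /=.
elim: s => [|a s IHs] red_s; first by rewrite big_nil.
have red_s' := reduced_tail red_s.
rewrite big_cons -[in LHS]push_cons // [in LHS]IHs //.
by case: a {IHs red_s} => t [].
Qed.

Lemma fg_lift_uniq (T : choiceType) (G : groupType)
    (h : {multiplicative free_group T -> G}) (f : T -> G) :
  (forall t, h (gen t) = f t) -> h =1 fg_lift f.
Proof.
move=> hE; have h1 : h 1 = 1.
  by apply: (@mulgI _ (h 1)); rewrite -gmulfM !mulg1.
have hV y : h y^-1 = (h y)^-1.
  by apply: (@mulgI _ (h y)); rewrite -gmulfM !mulgV.
move=> x; rewrite [in LHS](fg_prod_letters x) /fg_lift.
elim: (word x) => [|a s IHs]; first by rewrite !big_nil.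
rewrite !big_cons gmulfM IHs; congr (_ * _).
by case: a => t [] /=; rewrite /letter_val /= ?hV hE.
Qed.

(* The permutational wreath product G wr_A Sym(A). *)
Section Wreath.
Variables (A : finType) (G : groupType).

Record wreath := Wreath { deco : {ffun A -> G}; wperm : {perm A} }.

Definition wreath_pair (x : wreath) := (deco x, wperm x).
Definition pair_wreath (p : {ffun A -> G} * {perm A}) := Wreath p.1 p.2.

Lemma wreath_pairK : cancel wreath_pair pair_wreath.
Proof. by case. Qed.

HB.instance Definition _ := Choice.copy wreath (can_type wreath_pairK).

Definition perm_act (p : {perm A}) (g : {ffun A -> G}) : {ffun A -> G} :=
  [ffun j => g (p^-1 j)].

(* Permutations compose here as functions, from right to left, whereas
   (s * t) j = t (s j) in {perm A}: the composite of p and r is r * p. *)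
Definition wreath_mul (x y : wreath) :=
  Wreath (deco x * perm_act (wperm x) (deco y)) (wperm y * wperm x).

Definition wreath_one := Wreath 1 1.

Definition wreath_inv (x : wreath) :=
  Wreath (perm_act (wperm x)^-1 (deco x)^-1) (wperm x)^-1.

Lemma wreath_mulA : associative wreath_mul.
Proof.
case=> [g p] [h r] [k s]; congr Wreath; rewrite /= ?mulgA //.
by apply/ffunP=> j; rewrite !ffunE invMg permM mulgA.
Qed.

Lemma wreath_mul1g : left_id wreath_one wreath_mul.
Proof.
case=> [g p]; congr Wreath; rewrite /= ?mulg1 // mul1g.
by apply/ffunP=> j; rewrite !ffunE invg1 perm1.
Qed.

Lemma wreath_mulg1 : right_id wreath_one wreath_mul.
Proof.
case=> [g p]; congr Wreath; rewrite /= ?mul1g //.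
by apply/ffunP=> j; rewrite !ffunE mulg1.
Qed.

Lemma wreath_mulVg : left_inverse wreath_one wreath_inv wreath_mul.
Proof.
case=> [g p]; congr Wreath; rewrite /= ?mulgV //.
by apply/ffunP=> j; rewrite !ffunE mulVg.
Qed.

Lemma wreath_mulgV : right_inverse wreath_one wreath_inv wreath_mul.
Proof.
case=> [g p]; congr Wreath; rewrite /= ?mulVg //.
by apply/ffunP=> j; rewrite !ffunE invgK permKV mulgV.
Qed.

HB.instance Definition _ :=
  isGroup.Build wreath
    wreath_mulA wreath_mul1g wreath_mulg1 wreath_mulVg wreath_mulgV.

End Wreath.

(* Indices live in 'Z_q, which is the ring Z/q only when q > 1. *)
Section ThueMorse.
Variable q : nat.

Definition F := free_group 'Z_q.

Definition x_ (i : 'Z_q) : F := gen i.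

Definition shift : {perm 'Z_q} := perm (@addIr 'Z_q 1%R).

Lemma shiftE (j : 'Z_q) : shift j = (j + 1)%R.
Proof. by rewrite permE. Qed.

Definition phi : F -> wreath 'Z_q F :=
  fg_lift (fun i : 'Z_q =>
    Wreath (if i == 0%R then [ffun j => x_ j] else 1) shift).

Definition theta : F -> F :=
  fg_lift (fun i : 'Z_q => \prod_(0 <= k < q) x_ (i + k%:R)%R).

Definition gamma : F -> F := fg_lift (fun i : 'Z_q => x_ (i + 1)%R).

Lemma gamma_bij : bijective gamma.
Proof.
pose delta : F -> F := fg_lift (fun i : 'Z_q => x_ (i - 1)%R).
exists delta => x; rewrite [RHS]fg_prod_letters.
  apply: (fg_lift_uniq (h := fg_lift _ \o fg_lift _)) => i /=.
  by rewrite !fg_lift_gen addrK.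
apply: (fg_lift_uniq (h := fg_lift _ \o fg_lift _)) => i /=.
by rewrite !fg_lift_gen subrK.
Qed.

End ThueMorse.

(* Main.v *)
(** Both sides are multiplicative in [w], so it suffices to compare them on a
    generator [x_ i].  There [phi (theta (x_ i))] is a product of [q] factors
    that all have the permutation [shift], whose [q]-th power is trivial, and
    of which only the one with [i + k = 0] is decorated; the [k] shifts
    preceding it move the decoration [x_ (j - k) = x_ (i + j)] to position
    [j]. *)
Require Import Defs.
From HB Require Import structures.
From mathcomp Require Import all_boot all_fingroup all_algebra.

Set Implicit Arguments.
Unset Strict Implicit.
Unset Printing Implicit Defensive.

Import GRing.Theory.
Local Open Scope group_scope.

Section ThueMorseWreath.
Variable q : nat.
Implicit Types (i j : 'Z_q) (w : F q).

Lemma shiftX n j : (shift q ^+ n) j = (j + n%:R)%R.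
Proof.
elim: n j => [|n IHn] j; first by rewrite expg0 perm1 addr0.
by rewrite expgSr permM IHn shiftE -addrA natr1.
Qed.

Lemma shiftXV n j : (shift q ^+ n)^-1 j = (j - n%:R)%R.
Proof. by apply: (@perm_inj _ (shift q ^+ n)); rewrite permKV shiftX subrK. Qed.

Lemma iter_gammaM n : {morph iter n (@gamma q) : u v / u * v}.
Proof. by elim: n => // n IHn u v; rewrite !iterS IHn /gamma gmulfM. Qed.

Lemma iter_gamma_gen n i : iter n (@gamma q) (x_ i) = x_ (i + n%:R)%R.
Proof.
elim: n => [|n IHn]; first by rewrite addr0.
by rewrite iterS IHn /gamma fg_lift_gen -addrA natr1.
Qed.

(** The length [n] is left free so that induction can split off the last factor. For [n > q] the
    guard may hold several times, but all guarded factors are alike because [x_ (i + j)] does not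
    mention [k]. *)
Lemma phi_prod_gen i n :
  \prod_(0 <= k < n) phi (x_ (i + k%:R)%R) =
  Wreath [ffun j => \prod_(0 <= k < n | (i + k%:R == 0)%R) x_ (i + j)%R]
         (shift q ^+ n).
Proof.
elim: n => [|n IHn].
  rewrite big_nil; congr Wreath.
  by apply/ffunP=> j; rewrite !ffunE big_nil.
rewrite big_nat_recr //= IHn /phi fg_lift_gen.
congr Wreath; last by rewrite /= expgS.
apply/ffunP=> j; rewrite !ffunE /= shiftXV big_mkcond [RHS]big_mkcond.
rewrite [in RHS]big_nat_recr //=; congr (_ * _).
case: eqP => [/eqP|_]; last by rewrite ffunE.
by rewrite addr_eq0 => /eqP->; rewrite ffunE addrC.
Qed.

(** Naming the right-hand side as a function of [w] allows it to be declared a morphism, as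
    [fg_lift_uniq] requires. *)
Definition gamma_orbit w : wreath 'Z_q (F q) :=
  Wreath [ffun j : 'Z_q => iter j (@gamma q) w] 1.

Lemma gamma_orbit_morph : monoid.monoid_morphism gamma_orbit.
Proof.
(* An idempotent of a group is trivial. *)
have gamma1 n : iter n (@gamma q) 1 = 1.
  by apply: (@mulgI _ (iter n (@gamma q) 1)); rewrite -iter_gammaM !mulg1.
split=> [|u v]; congr Wreath; rewrite /= ?mulg1 //.
  by apply/ffunP=> j; rewrite !ffunE gamma1.
by apply/ffunP=> j; rewrite !ffunE invg1 perm1 iter_gammaM.
Qed.

HB.instance Definition _ :=
  isUMagmaMorphism.Build (F q) (wreath 'Z_q (F q)) gamma_orbit
    gamma_orbit_morph.

Lemma phi_theta_gen i :
  (1 < q)%N -> phi (theta (x_ i)) = gamma_orbit (x_ i).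
Proof.
(* Here [1 < q] matters: it makes [0, ..., q-1] the representatives of ['Z_q]. *)
move=> q_gt1; have natZ k : (k < q)%N -> (k%:R%R : 'Z_q) = k :> nat.
  by move=> lt_kq; rewrite val_Zp_nat // modn_small.
have ltZ j : (j < q)%N by rewrite -[X in (_ < X)%N](Zp_cast q_gt1).
rewrite /theta fg_lift_gen.
rewrite [LHS]gmulf_prod phi_prod_gen; congr Wreath; last first.
  by apply/permP=> j; rewrite shiftX perm1 pchar_Zp // addr0.
apply/ffunP=> j; rewrite !ffunE iter_gamma_gen natr_Zp.
(* With [k < q] inside the guard, [i + k = 0] singles out one [k], the representative of [- i], so a
   single factor survives. *)
rewrite big_nat_cond.
rewrite (eq_bigl (fun k => (0 <= k < q)%N && (k == (- i)%R :> nat))).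
  by rewrite -big_nat_cond big_nat1_eq ltZ.
move=> k /=; case: (ltnP k q) => //= lt_kq.
by rewrite addrC addr_eq0 -val_eqE /= natZ.
Qed.

End ThueMorseWreath.

Theorem lemma1p1 (q : nat) (hq : (1 < q)%N) (w : F q) :
  phi (theta w) =
  Wreath [ffun j : 'Z_q => iter (j : nat) (@gamma q) w] (1%g : {perm 'Z_q}).
Proof.
transitivity (fg_lift (fun i => gamma_orbit (x_ i)) w).
  apply: (fg_lift_uniq (h := fg_lift _ \o fg_lift _)) => i.
  exact: phi_theta_gen.
by symmetry; apply: (fg_lift_uniq (h := @gamma_orbit q)).
Qed.
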